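(* Let $\mu_1,\mu_2$ be positive measures on the real line, all of whose moments exist, and suppose that all multi-indices $(n,m)\in\mathbb{N}^2$ are normal. Then there are coefficients $a_{n,m},b_{n,m},c_{n,m},d_{n,m}$ ($n,m\ge 0$), with $a_{0,m}=0$ and $b_{n,0}=0$ for all $n,m\ge0$, such that the type II multiple orthogonal polynomials $P_{n,m}$ for $(\mu_1,\mu_2)$ satisfy, for all $n,m\ge 0$, the system of recurrence relations $$P_{n+1,m}(x)=(x-c_{n,m})P_{n,m}(x)-a_{n,m}P_{n-1,m}(x)-b_{n,m}P_{n,m-1}(x),$$ $$P_{n,m+1}(x)=(x-d_{n,m})P_{n,m}(x)-a_{n,m}P_{n-1,m}(x)-b_{n,m}P_{n,m-1}(x)$$ (where a term whose polynomial has a negative index has coefficient $0$ and is absent).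
   Context: $\mathbb{N}=\{0,1,2,\dots\}$. The type II multiple orthogonal polynomial $P_{n,m}$ is the monic polynomial of degree $n+m$ with $\int P_{n,m}(x)x^k\,d\mu_1(x)=0$ for $0\le k\le n-1$ and $\int P_{n,m}(x)x^k\,d\mu_2(x)=0$ for $0\le k\le m-1$. The index $(n,m)$ is called normal if the $(n+m)\times(n+m)$ matrix $M_{n,m}$ is nonsingular, where $M_{n,m}$ consists of two blocks side by side: the $(n+m)\times n$ matrix $(\nu^{(1)}_{s+t})$, $0\le s\le n+m-1$, $0\le t\le n-1$, and the $(n+m)\times m$ matrix $(\nu^{(2)}_{s+t})$, $0\le s\le n+m-1$, $0\le t\le m-1$, with $\nu^{(j)}_k=\int x^k\,d\mu_j(x)$ (for $(n,m)=(0,0)$ the empty matrix, considered nonsingular). Normality of $(n,m)$ is equivalent to existence and uniqueness of $P_{n,m}$. *)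

(* Defs.v *)
From HB Require Import structures.
From mathcomp Require Import all_boot all_order all_algebra.
From mathcomp Require Import all_classical all_reals all_analysis.
Set Implicit Arguments.
Unset Strict Implicit.
Unset Printing Implicit Defensive.
Import Order.TTheory GRing.Theory Num.Theory.
Import numFieldNormedType.Exports.
Local Open Scope ring_scope.

(* The case k = 0 forces mu to be finite. *)
Definition has_moments (R : realType)
    (mu : {measure set (measurableTypeR R) -> \bar R}) : Prop :=
  forall k : nat, mu.-integrable setT (fun x : R => (x ^+ k)%:E).

Definition moment (R : realType)
    (mu : {measure set (measurableTypeR R) -> \bar R}) (k : nat) : R :=
  (\int[mu]_x ((x : R) ^+ k))%R.

Definition moment_mx (R : realType)
    (mu1 mu2 : {measure set (measurableTypeR R) -> \bar R}) (n m : nat) :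
    'M[R]_(n + m) :=
  row_mx (\matrix_(s < n + m, t < n) moment mu1 (s + t))
         (\matrix_(s < n + m, t < m) moment mu2 (s + t)).

(* For (n, m) = (0, 0) the determinant of the empty matrix is 1, so this holds. *)
Definition normal_index (R : realType)
    (mu1 mu2 : {measure set (measurableTypeR R) -> \bar R}) (n m : nat) : Prop :=
  moment_mx mu1 mu2 n m \in unitmx.

(* [size p = (n + m).+1] says that p has degree n + m. *)
Definition typeII_mop (R : realType)
    (mu1 mu2 : {measure set (measurableTypeR R) -> \bar R}) (n m : nat)
    (p : {poly R}) : Prop :=
  [/\ p \is monic,
      size p = (n + m).+1,
      forall k : nat, (k < n)%N -> (\int[mu1]_x (p.[x] * (x : R) ^+ k))%R = 0
    & forall k : nat, (k < m)%N -> (\int[mu2]_x (p.[x] * (x : R) ^+ k))%R = 0].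

(* Main.v *)
(* Normality of (n,m) says that a polynomial of degree < n+m satisfying the n+m
   orthogonality conditions of index (n,m) vanishes.  Let T be P_{n+1,m} or
   P_{n,m+1}.  With c chosen to cancel the coefficient of x^{n+m}, the polynomial
   T - (x - c) P_{n,m} has degree < n+m and satisfies the conditions of index
   (n-1,m-1).  Adding a P_{n-1,m} repairs the condition at x^{n-1} for mu1 and
   keeps all those for mu2; b P_{n,m-1} does the same with the roles exchanged.
   The repaired polynomial is therefore 0.  As T itself satisfies the conditions
   of index (n,m), a and b depend on P_{n,m} only, not on the choice of T; they
   are well defined because int P_{n-1,m} x^{n-1} dmu1 = 0 would contradict the
   normality of (n,m). *)
Require Import Defs.
From HB Require Import structures.
From mathcomp Require Import all_boot all_order all_algebra.
From mathcomp Require Import all_classical all_reals all_analysis.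
From mathcomp Require Import ring.
Import Order.TTheory GRing.Theory Num.Theory.
Local Open Scope ring_scope.

(** The functional ['X^i] ↦ [u i], an algebraic stand-in for integration against a measure with
    moments [u]; orthogonality and the recurrences are then treated over any field. *)
Definition moment_form {F : fieldType} (u : nat -> F) (p : {poly F}) : F :=
  \sum_(i < size p) p`_i * u i.

Lemma moment_form_wide {F : fieldType} (u : nat -> F) (N : nat) (p : {poly F}) :
  (size p <= N)%N -> moment_form u p = \sum_(i < N) p`_i * u i.
Proof.
move=> leN; rewrite /moment_form (big_ord_widen _ (fun i => p`_i * u i) leN).
rewrite big_mkcond; apply: eq_bigr => i _; case: ltnP => // lei.
by rewrite nth_default ?mul0r.
Qed.

Lemma moment_form_is_scalar {F : fieldType} (u : nat -> F) :
  scalar (moment_form u).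
Proof.
move=> a p q; set N := maxn (size p) (size q).
have szp : (size p <= N)%N by rewrite leq_maxl.
have szq : (size q <= N)%N by rewrite leq_maxr.
have szpq : (size (a *: p + q)%R <= N)%N.
  rewrite (leq_trans (size_polyD _ _))// geq_max szq.
  by rewrite (leq_trans (size_scale_leq _ _)).
rewrite !(moment_form_wide _ N)// mulr_sumr -big_split; apply: eq_bigr => i _.
by rewrite coefD coefZ mulrDl mulrA.
Qed.

HB.instance Definition _ (F : fieldType) (u : nat -> F) :=
  GRing.isLinear.Build F {poly F} F *%R (moment_form u)
    (moment_form_is_scalar u).

Lemma moment_formXn {F : fieldType} (u : nat -> F) (k : nat) :
  moment_form u 'X^k = u k.
Proof.
rewrite /moment_form size_polyXn big_ord_recr /= coefXn eqxx mul1r.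
by rewrite big1 ?add0r// => i _; rewrite coefXn ltn_eqF ?mul0r.
Qed.

Lemma moment_form_mulXn {F : fieldType} (u : nat -> F) (N k : nat)
    (p : {poly F}) :
  (size p <= N)%N ->
  moment_form u (p * 'X^k) = \sum_(i < N) p`_i * u (i + k)%N.
Proof.
move=> leN; have {1}-> : p = \sum_(i < N) p`_i *: 'X^i.
  rewrite -poly_def; apply/polyP => i; rewrite coef_poly.
  by case: ltnP => // lei; rewrite nth_default// (leq_trans leN).
rewrite mulr_suml linear_sum; apply: eq_bigr => i _ /=.
by rewrite -scalerAl -exprD linearZ /= moment_formXn.
Qed.

Definition orth {F : fieldType} (u : nat -> F) (n : nat) (p : {poly F}) : Prop :=
  forall k : nat, (k < n)%N -> moment_form u (p * 'X^k) = 0.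

Lemma orthW {F : fieldType} (u : nat -> F) (n n' : nat) (p : {poly F}) :
  (n <= n')%N -> orth u n' p -> orth u n p.
Proof. by move=> le_n o k ltk; apply/o/(leq_trans ltk). Qed.

Lemma orthD {F : fieldType} (u : nat -> F) (n : nat) (p q : {poly F}) :
  orth u n p -> orth u n q -> orth u n (p + q).
Proof. by move=> op oq k ltk; rewrite mulrDl linearD /= op// oq// addr0. Qed.

Lemma orthZ {F : fieldType} (u : nat -> F) (n : nat) (a : F) (p : {poly F}) :
  orth u n p -> orth u n (a *: p).
Proof. by move=> op k ltk; rewrite -scalerAl linearZ /= op// mulr0. Qed.

Lemma orthB {F : fieldType} (u : nat -> F) (n : nat) (p q : {poly F}) :
  orth u n p -> orth u n q -> orth u n (p - q).
Proof. by move=> op oq; rewrite -scaleN1r; apply/orthD/orthZ. Qed.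

Lemma orthMX {F : fieldType} (u : nat -> F) (n : nat) (p : {poly F}) :
  orth u n p -> orth u n.-1 ('X * p).
Proof. by case: n => // n op k ltk; rewrite -mulrA mulrCA -exprS; apply: op. Qed.

Lemma orthS {F : fieldType} (u : nat -> F) (n : nat) (p : {poly F}) :
  orth u n p -> moment_form u (p * 'X^n) = 0 -> orth u n.+1 p.
Proof. by move=> o h k; rewrite ltnS leq_eqVlt => /orP[/eqP->//|]; apply: o. Qed.

Definition mixed_moment_mx {F : fieldType} (u v : nat -> F) (n m : nat) :
    'M[F]_(n + m) :=
  row_mx (\matrix_(s < n + m, t < n) u (s + t)%N)
         (\matrix_(s < n + m, t < m) v (s + t)%N).

(** Invertibility of the matrix is used through this identity twice: injectivity gives uniqueness in
    [normal_orth_eq0], surjectivity gives existence in [mop_orth]. *)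
Lemma mulmx_mixed_moment_mx {F : fieldType} (u v : nat -> F) (n m : nat)
    (r : 'rV_(n + m)) :
  r *m mixed_moment_mx u v n m =
  row_mx (\row_t moment_form u (rVpoly r * 'X^t))
         (\row_t moment_form v (rVpoly r * 'X^t)).
Proof.
have sz : (size (rVpoly r) <= n + m)%N by apply: size_poly.
rewrite mul_mx_row; congr row_mx; apply/rowP => t; rewrite !mxE;
  rewrite (moment_form_mulXn _ _ _ _ sz); apply: eq_bigr => i _;
  by rewrite mxE coef_rVpoly_ord.
Qed.

Lemma normal_orth_eq0 {F : fieldType} (u v : nat -> F) (n m : nat)
    (p : {poly F}) :
  mixed_moment_mx u v n m \in unitmx -> (size p <= n + m)%N ->
  orth u n p -> orth v m p -> p = 0.
Proof.
move=> unitM szp ou ov; rewrite -(poly_rV_K szp).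
rewrite (_ : poly_rV p = 0) ?linear0// -[poly_rV p](mulmxK unitM).
rewrite mulmx_mixed_moment_mx poly_rV_K// (_ : row_mx _ _ = 0) ?mul0mx//.
rewrite -row_mx0; congr row_mx; apply/rowP => t; rewrite !mxE.
  exact: ou.
exact: ov.
Qed.

(** The row vector lists the pairings of ['X^(n + m)] with the test monomials. Under normality the
    subtracted polynomial, of degree below [n + m], has the same pairings. *)
Definition mop {F : fieldType} (u v : nat -> F) (n m : nat) : {poly F} :=
  'X^(n + m) - rVpoly (row_mx (\row_(t < n) u (n + m + t)%N)
                              (\row_(t < m) v (n + m + t)%N)
                       *m invmx (mixed_moment_mx u v n m)).

Lemma size_mop {F : fieldType} (u v : nat -> F) (n m : nat) :
  size (mop u v n m) = (n + m).+1%N.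
Proof.
by rewrite size_polyDl size_polyXn// size_polyN ltnS; apply: size_poly.
Qed.

Lemma mop_monic {F : fieldType} (u v : nat -> F) (n m : nat) :
  mop u v n m \is monic.
Proof.
rewrite monicE lead_coefDl ?lead_coefXn// size_polyXn size_polyN ltnS.
exact: size_poly.
Qed.

Lemma mop_orth {F : fieldType} (u v : nat -> F) (n m : nat) :
  mixed_moment_mx u v n m \in unitmx ->
  orth u n (mop u v n m) /\ orth v m (mop u v n m).
Proof.
move=> unitM; rewrite /mop; set w := row_mx _ _; set r := w *m _.
have : r *m mixed_moment_mx u v n m = w by apply: mulmxKV.
rewrite mulmx_mixed_moment_mx => /eq_row_mx[/rowP ru /rowP rv].
split=> k ltk; rewrite mulrBl linearB /= -exprD moment_formXn.
  by have := ru (Ordinal ltk); rewrite !mxE /= => ->; rewrite subrr.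
by have := rv (Ordinal ltk); rewrite !mxE /= => ->; rewrite subrr.
Qed.

Lemma monic_sub_size {F : fieldType} (p q : {poly F}) (N : nat) :
  p \is monic -> q \is monic -> size p = N.+1 -> size q = N.+1 ->
  (size (p - q)%R <= N)%N.
Proof.
move=> /monicP mp /monicP mq szp szq; apply/leq_sizeP => j.
rewrite coefB leq_eqVlt => /orP[/eqP<-|ltj].
  by move: mp mq; rewrite !lead_coefE szp szq /= => -> ->; rewrite subrr.
by rewrite !nth_default ?subrr ?szp ?szq.
Qed.

(** Otherwise [p] would meet all conditions of index [(n.+1, m)] with degree only [n + m], and
    normality would force [p = 0]. *)
Lemma next_moment_neq0l {F : fieldType} (u v : nat -> F) (n m : nat)
    (p : {poly F}) :
  mixed_moment_mx u v n.+1 m \in unitmx -> p \is monic ->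
  size p = (n + m).+1%N -> orth u n p -> orth v m p ->
  moment_form u (p * 'X^n) != 0.
Proof.
move=> unitM mp szp ou ov; apply: contraNneq (monic_neq0 mp).
move=> /(orthS _ _ _ ou) ou'; apply/eqP.
by apply: (normal_orth_eq0 _ _ _ _ _ unitM _ ou' ov); rewrite szp.
Qed.

Lemma next_moment_neq0r {F : fieldType} (u v : nat -> F) (n m : nat)
    (p : {poly F}) :
  mixed_moment_mx u v n m.+1 \in unitmx -> p \is monic ->
  size p = (n + m).+1%N -> orth u n p -> orth v m p ->
  moment_form v (p * 'X^m) != 0.
Proof.
move=> unitM mp szp ou ov; apply: contraNneq (monic_neq0 mp).
move=> /(orthS _ _ _ ov) ov'; apply/eqP.
by apply: (normal_orth_eq0 _ _ _ _ _ unitM _ ou ov'); rewrite szp addnS.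
Qed.

(* For p = P_{n,m} and q = P_{n-1,m} this is a_{n,m}; with the second measure,
   q = P_{n,m-1} and m instead of n it is b_{n,m}. *)
Definition neighbor_coef {F : fieldType} (u : nat -> F) (n : nat)
    (p q : {poly F}) : F :=
  if n is n'.+1 then moment_form u (p * 'X^n) / moment_form u (q * 'X^n') else 0.

(** Multiplication by ['X] costs one condition, and [neighbor_coef] is chosen to restore it. Only
    one functional is involved, so the lemma serves both measures, with [q] and [r] exchanged. *)
Lemma orth_recurrence_defect {F : fieldType} (u : nat -> F) (n : nat) (b c : F)
    (t p q r : {poly F}) :
  orth u n t -> orth u n p -> orth u n.-1 q -> orth u n r ->
  ((0 < n)%N -> moment_form u (q * 'X^(n.-1)) != 0) ->
  orth u n (t - 'X * p + c *: p + neighbor_coef u n p q *: q + b *: r).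
Proof.
move=> ot op oq or q_neq0; apply/orthD/orthZ => //.
(* The term [c *: p] already meets all conditions and is split off; the rest needs care only at the
   last exponent. *)
case: n => // n in ot op oq or q_neq0 *; rewrite addrAC; apply/orthD/orthZ => //.
apply: orthS => /=.
  apply/orthD/orthZ => //; apply: orthB; first exact: orthW ot.
  exact: (orthMX u n.+1).
rewrite !mulrDl mulNr -scalerAl !linearD linearN linearZ /= ot// add0r.
by rewrite -mulrA mulrCA -exprS divfK ?addNr// q_neq0.
Qed.

Lemma nearest_neighbor_recurrence {F : fieldType} (u v : nat -> F)
    (P : nat -> nat -> {poly F}) :
  (forall n m, mixed_moment_mx u v n m \in unitmx) ->
  (forall n m, P n m \is monic) -> (forall n m, size (P n m) = (n + m).+1%N) ->
  (forall n m, orth u n (P n m)) -> (forall n m, orth v m (P n m)) ->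
  forall (n m : nat) (t : {poly F}),
  t \is monic -> size t = (n + m).+2%N -> orth u n t -> orth v m t ->
  t = ('X - (('X * P n m - t)`_(n + m))%:P) * P n m
      - neighbor_coef u n (P n m) (P n.-1 m) *: P n.-1 m
      - neighbor_coef v m (P n m) (P n m.-1) *: P n m.-1.
Proof.
move=> normal mP szP ouP ovP n m t mt szt out ovt.
set c := _`_ _; set a := neighbor_coef u _ _ _; set b := neighbor_coef v _ _ _.
set d := t - 'X * P n m + c *: P n m + a *: P n.-1 m + b *: P n m.-1.
suff d0 : d = 0.
  apply: subr0_eq; rewrite -[RHS]d0 /d -!mul_polyC; ring.
apply: (normal_orth_eq0 _ _ n m _ (normal n m)).
- rewrite /d -addrA (leq_trans (size_polyD _ _))// geq_max; apply/andP; split.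
    (* At [n + m] the choice of [c] cancels the coefficient; above it, [t] and ['X * P n m] are
       monic of equal degree. *)
    apply/leq_sizeP => j; rewrite leq_eqVlt => /orP[/eqP<-|ltj].
      rewrite coefD coefZ.
      have := monicP (mP n m); rewrite lead_coefE szP /= => ->.
      by rewrite mulr1 /c -(opprB t) coefN subrr.
    rewrite coefD coefZ !nth_default ?szP ?mulr0 ?addr0//.
    apply: leq_trans ltj; apply: monic_sub_size => //.
      by rewrite rpredM ?monicX.
    by rewrite mulrC size_mulX ?szP// monic_neq0.
  rewrite (leq_trans (size_polyD _ _))// geq_max; apply/andP; split.
    (* For [n = 0] the polynomial [P n.-1 m] is [P n m] itself, too large for the bound, but its
       coefficient is 0. *)
    rewrite /a; case: (n) => [|n'] /=; first by rewrite scale0r size_poly0.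
    by rewrite (leq_trans (size_scale_leq _ _))// szP.
  rewrite /b; case: (m) => [|m'] /=; first by rewrite scale0r size_poly0.
  by rewrite (leq_trans (size_scale_leq _ _))// szP addnS.
- apply: orth_recurrence_defect => //.
  case: (n) => // n' _; exact: (next_moment_neq0l u v n' m).
(* Exchanging the last two terms puts [P n m.-1] in the role of [q]. *)
- rewrite /d addrAC; apply: orth_recurrence_defect => //.
  case: (m) => // m' _; exact: (next_moment_neq0r u v n m').
Qed.

(** Each monomial is integrable, so the integral passes through the finite sum. *)
Lemma Rintegral_horner {R : realType}
    (mu : {measure set (measurableTypeR R) -> \bar R}) (p : {poly R}) :
  has_moments mu -> (\int[mu]_x p.[x])%R = moment_form (moment mu) p.
Proof.
move=> mom; have int_term (i : 'I_(size p)) :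
    mu.-integrable setT (fun x => (p`_i * x ^+ i)%:E).
  by under eq_fun do rewrite EFinM; apply/integrableZl/mom.
rewrite /Rintegral.
under eq_integral do rewrite horner_coef -sumEFin.
rewrite integral_sum// -sum_fine; last by move=> i _; apply: integrable_fin_num.
apply: eq_bigr => i _.
rewrite -[LHS]/((\int[mu]_x (p`_i * x ^+ i))%R) RintegralZl//.
exact: mom.
Qed.

Lemma typeII_mopP {R : realType}
    (mu1 mu2 : {measure set (measurableTypeR R) -> \bar R})
    (mom1 : has_moments mu1) (mom2 : has_moments mu2) (n m : nat)
    (p : {poly R}) :
  typeII_mop mu1 mu2 n m p <->
  [/\ p \is monic, size p = (n + m).+1%N,
      orth (moment mu1) n p & orth (moment mu2) m p].
Proof.
have intE mu k : has_moments mu ->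
    (\int[mu]_x (p.[x] * x ^+ k))%R = moment_form (moment mu) (p * 'X^k).
  move=> mom; rewrite -Rintegral_horner//.
  by under eq_Rintegral do rewrite -[X in _ * X]hornerXn -hornerM.
split=> -[mp szp o1 o2]; split=> // k ltk.
- by rewrite -intE// o1.
- by rewrite -intE// o2.
- by rewrite intE// o1.
- by rewrite intE// o2.
Qed.

(* [unique Q p] is [Q p /\ forall p', Q p' -> p = p']: P is the family of type
   II multiple orthogonal polynomials.  When n = 0 (resp. m = 0) the term
   P n.-1 m (resp. P n m.-1) stands for the absent polynomial of negative index;
   its coefficient is 0. *)
Theorem theorem2p1 (R : realType)
    (mu1 mu2 : {measure set (measurableTypeR R) -> \bar R})
    (mom1 : has_moments mu1) (mom2 : has_moments mu2)
    (normal_all : forall n m : nat, normal_index mu1 mu2 n m) :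
  exists P : nat -> nat -> {poly R},
    (forall n m : nat, unique (typeII_mop mu1 mu2 n m) (P n m)) /\
    exists a b c d : nat -> nat -> R,
      [/\ forall m : nat, a 0%N m = 0,
          forall n : nat, b n 0%N = 0,
          forall n m : nat,
            P n.+1 m = ('X - (c n m)%:P) * P n m
                       - a n m *: P n.-1 m - b n m *: P n m.-1
        & forall n m : nat,
            P n m.+1 = ('X - (d n m)%:P) * P n m
                       - a n m *: P n.-1 m - b n m *: P n m.-1].
Proof.
set u := moment mu1; set v := moment mu2.
(* With [u] and [v] the moment sequences, [mixed_moment_mx] is convertible to [moment_mx]. *)
have normal n m : mixed_moment_mx u v n m \in unitmx by exact: normal_all.
have ou n m : orth u n (mop u v n m) by case: (mop_orth u v n m).
have ov n m : orth v m (mop u v n m) by case: (mop_orth u v n m).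
exists (mop u v); split=> [n m|].
  split=> [|p /(typeII_mopP _ _ mom1 mom2)[mp szp oup ovp]].
    by apply/(typeII_mopP _ _ mom1 mom2); split; rewrite ?mop_monic ?size_mop.
  (* Uniqueness: the difference of two monic solutions has degree below [n + m] and still meets all
     conditions. *)
  apply/subr0_eq/(normal_orth_eq0 u v n m) => //; try exact: orthB.
  by apply: monic_sub_size; rewrite ?mop_monic ?size_mop.
exists (fun n m => neighbor_coef u n (mop u v n m) (mop u v n.-1 m)).
exists (fun n m => neighbor_coef v m (mop u v n m) (mop u v n m.-1)).
exists (fun n m => ('X * mop u v n m - mop u v n.+1 m)`_(n + m)).
exists (fun n m => ('X * mop u v n m - mop u v n m.+1)`_(n + m)).
split=> // n m; apply: nearest_neighbor_recurrence;
  rewrite ?mop_monic ?size_mop ?addnS//.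
- by move=> *; apply: mop_monic.
- by move=> *; apply: size_mop.
- exact: orthW (ou _ _).
- by move=> *; apply: mop_monic.
- by move=> *; apply: size_mop.
- exact: orthW (ov _ _).
Qed.
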